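(* Let $V\subseteq R_d$ be a monomial vector space which is both Gotzmann and Gotzmann-dual. Then $V$ is a lex segment with respect to some ordering of the variables, i.e. there is an ordering $x_{\pi(1)}>\dots>x_{\pi(n)}$ such that $V$ is spanned by an initial segment of the squarefree degree-$d$ monomials in the corresponding lexicographic order.
   Context: Let $\Bbbk$ be a field, $R=\Bbbk[x_1,\dots,x_n]/(x_1^2,\dots,x_n^2)$, $R_d$ its degree-$d$ component. A monomial vector space is a subspace of some $R_d$ spanned by monomials; $\mathbf m_1V$ is the span of $\{x_jm\}$ over monomials $m\in V$ and all $j$. A subspace $V\subseteq R_d$ is Gotzmann if $|\mathbf m_1V|\le|\mathbf m_1W|$ for every subspace $W\subseteq R_d$ with $|W|=|V|$ ($|\cdot|$ = dimension). The Alexander dual of a monomial vector space $V\subseteq R_d$ is $V^\vee\subseteq R_{n-d}$, spanned by the monomials $\mathbf x/m$ for squarefree monomials $m$ of degree $d$ not in $V$, where $\mathbf x=x_1\cdots x_n$. $V$ is Gotzmann-dual if $V^\vee$ is Gotzmann. *)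

(* Defs.v *)
From HB Require Import structures.
From mathcomp Require Import all_boot all_order all_algebra all_fingroup.
Unset Printing Implicit Defensive.
Import GRing.Theory.
Local Open Scope ring_scope.

(* The exterior-face ring R = K[x_1..x_n]/(x_1^2,..,x_n^2) as a K-vector space:
   a squarefree monomial is identified with its support A : {set 'I_n};
   an element of R is its coefficient function. *)
Definition RR (K : fieldType) (n : nat) := {ffun {set 'I_n} -> K^o}.

Definition mono (K : fieldType) (n : nat) (A : {set 'I_n}) : RR K n :=
  [ffun T => (T == A)%:R].

Definition Rdeg (K : fieldType) (n d : nat) : {vspace RR K n} :=
  <<[seq mono K n A | A <- enum [set A : {set 'I_n} | #|A| == d]]>>%VS.

Definition mulx_fun (K : fieldType) (n : nat) (j : 'I_n) (f : RR K n) : RR K n :=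
  [ffun T : {set 'I_n} => if j \in T then f (T :\ j) else 0].

Lemma mulx_fun_linear (K : fieldType) (n : nat) (j : 'I_n) :
  linear (@mulx_fun K n j).
Proof.
move=> a f g; apply/ffunP => T; rewrite !ffunE.
by case: (j \in T); rewrite ?ffunE // scaler0 addr0.
Qed.

HB.instance Definition _ (K : fieldType) (n : nat) (j : 'I_n) :=
  GRing.isLinear.Build K (RR K n) (RR K n) _ (@mulx_fun K n j)
    (@mulx_fun_linear K n j).

Definition mulx (K : fieldType) (n : nat) (j : 'I_n) : 'End(RR K n) :=
  linfun (@mulx_fun K n j).

Definition m1 (K : fieldType) (n : nat) (W : {vspace RR K n}) : {vspace RR K n} :=
  (\sum_(j < n) (mulx K n j @: W))%VS.

Definition Gotzmann (K : fieldType) (n d : nat) (V : {vspace RR K n}) : Prop :=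
  forall W : {vspace RR K n}, (W <= Rdeg K n d)%VS -> \dim W = \dim V ->
    (\dim (m1 K n V) <= \dim (m1 K n W))%N.

Definition monvs (K : fieldType) (n : nat) (M : {set {set 'I_n}}) : {vspace RR K n} :=
  <<[seq mono K n A | A <- enum M]>>%VS.

Definition alexdual (n d : nat) (M : {set {set 'I_n}}) : {set {set 'I_n}} :=
  [set ~: A | A in [set A : {set 'I_n} | (#|A| == d) && (A \notin M)]].

Definition Gotzmann_dual (K : fieldType) (n d : nat) (M : {set {set 'I_n}}) : Prop :=
  Gotzmann K n (n - d) (monvs K n (alexdual n d M)).

(* Lex order for the variable ordering in which x_i has rank s i
   (rank 0 = largest variable): T >lex A iff at the highest-ranked variable
   where they differ, T contains it. *)
Definition lex_gt (n : nat) (s : {perm 'I_n}) (T A : {set 'I_n}) : bool :=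
  [exists i, [&& i \in T, i \notin A &
     [forall j, (s j < s i)%N ==> ((j \in T) == (j \in A))]]].

Definition is_lex_segment (n d : nat) (M : {set {set 'I_n}}) : Prop :=
  exists s : {perm 'I_n}, forall A T : {set 'I_n},
    A \in M -> #|T| = d -> lex_gt n s T A -> T \in M.

(* Main.v *)
Require Import Defs.
From HB Require Import structures.
From mathcomp Require Import all_boot all_order all_algebra all_fingroup.
From mathcomp Require Import zify.

(* Comparing V only with monomial spaces and taking complements of supports,
   both hypotheses become minimality of lower shadows: that of the family G of
   d-sets outside M, and that of the family of complements of members of M.
   Kruskal and Katona give the minimum as a function kk of the size, defined
   recursively on the ground set.  The key point is that a family of k-subsets
   of an (m+1)-set which has minimum shadow and at most 'C(m, k) members leaves
   some point uncovered.  One of the two families is that small, so some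
   variable divides every monomial of V or some variable has all its multiples
   in V; up to Alexander duality it is the former, and then V / x satisfies the
   same hypotheses in one variable less.  The variable x is placed first. *)

Set Implicit Arguments.
Unset Strict Implicit.
Unset Printing Implicit Defensive.

(** * The Kruskal-Katona function *)

(* kk n k s is the size of the shadow of the first s k-subsets of an n-set in
   colexicographic order; for k = 0 the shadow is empty. *)
Fixpoint kk (n k s : nat) : nat :=
  match n, k with
  | n'.+1, k'.+1 =>
      if s <= 'C(n', k) then kk n' k s
      else 'C(n', k') + kk n' k' (s - 'C(n', k))
  | _, _ => 0
  end.

Lemma kk0k n s : kk n 0 s = 0.
Proof. by case: n. Qed.

Lemma kkS n k s :
  kk n.+1 k.+1 s = if s <= 'C(n, k.+1) then kk n k.+1 s
                   else 'C(n, k) + kk n k (s - 'C(n, k.+1)).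
Proof. by []. Qed.

Lemma kk_small n k s : s <= 'C(n, k) -> kk n.+1 k s = kk n k s.
Proof. by case: k => [|k] h; rewrite ?kk0k // kkS h. Qed.

Lemma kk_large n k s :
  'C(n, k.+1) < s -> kk n.+1 k.+1 s = 'C(n, k) + kk n k (s - 'C(n, k.+1)).
Proof. by move=> h; rewrite kkS leqNgt h. Qed.

Lemma kk_0 n k : kk n k 0 = 0.
Proof. by elim: n k => [|n IHn] [|k] //; rewrite kkS leq0n. Qed.

(** Pascal's rule closes the second branch of [kk]. There is no size condition: the bound also holds
    for [s] beyond ['C(n, k.+1)]. *)
Lemma kk_ub n k s : kk n k.+1 s <= 'C(n, k).
Proof.
elim: n k s => [|n IHn] k s //.
rewrite kkS; case: ifP => _.
  by apply: leq_trans (IHn k s) _; rewrite leq_bin2l.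
by case: k => [|k]; rewrite ?kk0k ?bin0 // binS leq_add2l.
Qed.

Lemma kk_gt0 n k s : 0 < s -> s <= 'C(n, k.+1) -> 0 < kk n k.+1 s.
Proof.
elim: n k s => [|n IHn] k s s0; first by rewrite bin0n leqn0; lia.
rewrite kkS binS; case: (leqP s 'C(n, k.+1)) => [h _|h1 h2]; first exact: IHn.
lia.
Qed.

Lemma kk_mono n k s t : s <= t -> kk n k s <= kk n k t.
Proof.
elim: n k s t => [|n IHn] [|k] s t st //.
rewrite !kkS; case: (leqP s) => hs; case: (leqP t) => ht.
- exact: IHn.
- by have := kk_ub n k s; lia.
- by lia.
- by rewrite leq_add2l IHn // leq_sub2r.
Qed.

(* With a = |del x F| and b = |link x F|, this is the inductive step of the
   Kruskal-Katona bound for families such that shadow (del x F) is contained in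
   link x F. *)
Lemma kk_shifted n k a b : a <= 'C(n, k.+1) -> b <= 'C(n, k) ->
  kk n k.+1 a <= b -> kk n.+1 k.+1 (a + b) <= b + kk n k b.
Proof.
elim: n k a b => [|n IHn] k a b.
  rewrite bin0n /= leqn0 => /eqP->; case: k => [|k] hb _.
    by case: b hb => [|[|b]].
  by case: b hb.
case: k => [|k] ha hb hab.
  case: b hb hab => [|b] _ hab; last first.
    by have := kk_ub n.+2 0 (a + b.+1); rewrite bin0; lia.
  rewrite addn0; case: (posnP a) => [->|a0]; first by rewrite kk_0.
  by have := @kk_gt0 _ _ _ a0 ha; lia.
rewrite 2!binS in ha hb; rewrite kkS in hab.
rewrite (kkS n.+1) (kkS n k b) !binS.
case: (leqP a 'C(n, k.+2)) hab => [ap|ap] hab; 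
  case: (leqP b 'C(n, k.+1)) => [bq|bq].
- rewrite ifT; last by lia.
  by apply: IHn.
(* When [a + b] exceeds the full layer, subtracting it leaves at most [b - 'C(n, k.+1)], because [a]
   is at most ['C(n, k.+2)]. The induction hypothesis with deletion size 0 then suffices. *)
- case: ifP => abq; first by have := kk_ub n.+1 k.+1 (a + b); rewrite binS; lia.
  have := @IHn k 0 (b - 'C(n, k.+1)); rewrite kk_0 add0n => /(_ _ _ _) IH.
  have := @kk_mono n.+1 k.+1 (a + b - ('C(n, k.+2) + 'C(n, k.+1)))
    (b - 'C(n, k.+1)).
  by lia.
(* Void case: positivity of [kk] at the excess of [a] turns [hab] into ['C(n, k.+1) < b]. *)
- by have := @kk_gt0 n k (a - 'C(n, k.+2)); lia.
- rewrite ifF; last by lia.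
  have := @IHn k (a - 'C(n, k.+2)) (b - 'C(n, k.+1)).
  have -> : a - 'C(n, k.+2) + (b - 'C(n, k.+1)) =
    a + b - ('C(n, k.+2) + 'C(n, k.+1)) by lia.
  by lia.
Qed.

(** * Shadows and shifting *)

Section Families.
Variable T : finType.
Implicit Types (A B S : {set T}) (F : {set {set T}}) (x y z : T).

Definition ksets S k := [set A : {set T} | A \subset S & #|A| == k].
Definition shadow F : {set {set T}} :=
  [set B : {set T} | [exists x, (x \notin B) && (x |: B \in F)]].
Definition link x F : {set {set T}} :=
  [set B : {set T} | (x \notin B) && (x |: B \in F)].
Definition del x F : {set {set T}} := [set A in F | x \notin A].

Lemma shadowP F B :
  reflect (exists2 x, x \notin B & x |: B \in F) (B \in shadow F).
Proof.
rewrite inE; apply: (iffP existsP) => [[x /andP[]]|[x h1 h2]]; exists x => //.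
by rewrite h1.
Qed.

Lemma card_link_del x F : #|F| = #|del x F| + #|link x F|.
Proof.
have inj : {in link x F &, injective (fun B => x |: B)}.
  move=> B C; rewrite !inE => /andP[xB _] /andP[xC _] e.
  by rewrite -(setU1K xB) -(setU1K xC) e.
rewrite -(card_in_imset inj) -(cardsID [set A : {set T} | x \notin A] F).
congr (_ + _); apply: eq_card => A; first by rewrite !inE.
rewrite !inE negbK; apply/andP/imsetP.
  move=> [xA AF]; exists (A :\ x); rewrite ?inE ?setD1K // eqxx.
  by [].
by case=> B; rewrite inE => /andP[_ BF] ->; rewrite setU11.
Qed.

Lemma link_shadow x F : link x (shadow F) = shadow (link x F).
Proof.
apply/setP => B; rewrite inE; apply/andP/shadowP.
  case=> xB /shadowP[y]; rewrite !inE negb_or => /andP[yx yB] h.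
  by exists y => //; rewrite !inE negb_or eq_sym yx xB setUCA.
case=> y yB; rewrite !inE negb_or => /andP[/andP[xy xB] h]; split => //.
by apply/existsP; exists y; rewrite !inE negb_or eq_sym xy yB setUCA.
Qed.

Lemma del_shadow x F : del x (shadow F) = shadow (del x F) :|: link x F.
Proof.
apply/setP => B; rewrite inE in_setU; apply/andP/orP.
  case=> /shadowP[y yB h] xB; case: (eqVneq x y) => [->|xy].
    by right; rewrite inE yB.
  by left; apply/shadowP; exists y => //; rewrite !inE h negb_or xy.
case=> [/shadowP[y yB]|]; rewrite !inE.
  rewrite negb_or => /andP[h /andP[_ xB]]; split => //.
  by apply/existsP; exists y; rewrite yB.
by case/andP=> xB h; split => //; apply/existsP; exists x; rewrite xB.
Qed.

(** Members of the shadow are sorted by whether they contain [x]. Those that avoid [x] arise by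
    removing a point from a member avoiding [x], or by removing [x] itself. The inductions on the
    ground set rest on this split. *)
Lemma card_shadow x F :
  #|shadow F| = #|shadow (del x F) :|: link x F| + #|shadow (link x F)|.
Proof. by rewrite (card_link_del x) link_shadow del_shadow. Qed.

Lemma in_ksets S k A : (A \in ksets S k) = (A \subset S) && (#|A| == k).
Proof. by rewrite inE. Qed.

Lemma card_ksets S k : #|ksets S k| = 'C(#|S|, k).
Proof. exact: cards_draws. Qed.

Lemma del_ksets x S k F : F \subset ksets S k -> del x F \subset ksets (S :\ x) k.
Proof.
move=> /subsetP h; apply/subsetP => A; rewrite inE => /andP[/h].
by rewrite !inE subsetD1 => /andP[-> ->] ->.
Qed.

Lemma link_ksets x S k F :
  F \subset ksets S k.+1 -> link x F \subset ksets (S :\ x) k.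
Proof.
move=> /subsetP h; apply/subsetP => A; rewrite inE => /andP[xA /h].
rewrite !inE subsetD1 xA andbT => /andP[s].
rewrite cardsU1 xA add1n eqSS => ->.
by rewrite andbT (subset_trans (subsetUr _ _) s).
Qed.

Section Shift.
Variables x y : T.
Hypothesis xy : x != y.
Let sw A : {set T} := [set z | tperm x y z \in A].
Let X : {set {set T}} := [set A : {set T} | (x \in A) && (y \notin A)].
Let Y : {set {set T}} := [set A : {set T} | (y \in A) && (x \notin A)].
(* Replaces y by x in the members containing y but not x, unless the result
   already belongs to F. *)
Definition shift F : {set {set T}} :=
  [set A | if A \in X then (A \in F) || (sw A \in F)
           else if A \in Y then (A \in F) && (sw A \in F) else A \in F].

Lemma swK : involutive sw.
Proof. by move=> A; apply/setP => z; rewrite !inE tpermK. Qed.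

Lemma card_sw (G : {set {set T}}) : #|[set A | sw A \in G]| = #|G|.
Proof.
rewrite -(card_imset _ (can_inj swK)); apply: eq_card => A.
apply/imsetP/idP => [[B]|GA]; first by rewrite inE => h ->.
by exists (sw A); rewrite ?inE swK.
Qed.

(** Compare [F :&: X] with the swapped copy of [F :&: Y]. After the shift, the part in [X] is their
    union and the part in [Y] is the swap of their intersection, so the two sizes keep their sum. *)
Lemma card_shift F : #|shift F| = #|F|.
Proof.
have split3 (H : {set {set T}}) :
    #|H| = #|H :&: X| + #|H :&: Y| + #|H :\: (X :|: Y)|.
  rewrite -(cardsID X H) -(cardsID Y (H :\: X)) addnA.
  by congr (_ + _ + _); apply: eq_card => A; rewrite !inE;
    case: (x \in A); case: (y \in A); rewrite ?andbT ?andbF.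
rewrite (split3 (shift F)) (split3 F); congr (_ + _); last first.
  apply: eq_card => A; rewrite !inE.
  by case: (x \in A); case: (y \in A).
have -> : shift F :&: X = (F :&: X) :|: [set A | (sw A \in F) && (sw A \in Y)].
  apply/setP => A; rewrite !inE tpermL tpermR.
  by case: (x \in A); case: (y \in A); rewrite ?andbT ?andbF.
have -> : #|shift F :&: Y| =
    #|(F :&: X) :&: [set A | (sw A \in F) && (sw A \in Y)]|.
  rewrite -card_sw; apply: eq_card => A.
  rewrite !inE !tpermL !tpermR swK.
  by case: (x \in A); case: (y \in A); rewrite ?andbT ?andbF //= andbC.
rewrite cardsUI; congr (_ + _).
by rewrite -(card_sw (F :&: Y)); apply: eq_card => A; rewrite !inE.
Qed.

Lemma swU1 z A : z != x -> z != y -> sw (z |: A) = z |: sw A.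
Proof.
move=> zx zy; apply/setP => t; rewrite !inE.
by case: tpermP => [->|->|//]; rewrite ![_ == z]eq_sym (negPf zx) (negPf zy).
Qed.

Lemma shiftE F A : (A \in shift F) =
  if x \in A then (A \in F) || (y \notin A) && (sw A \in F)
  else (A \in F) && ((y \in A) ==> (sw A \in F)).
Proof.
rewrite !inE; case: (x \in A); case: (y \in A); rewrite ?andbT ?orbF //=.
Qed.

Lemma swU1l A : x \notin A -> y \notin A -> sw (x |: A) = y |: A.
Proof.
move=> xA yA; apply/setP => t; rewrite !inE.
case: tpermP => [->|->|/eqP tx /eqP ty]; last by rewrite (negPf tx) (negPf ty).
  by rewrite (negPf xA) (negPf yA) !orbF eq_sym.
by rewrite !eqxx.
Qed.

(** With [card_shift] this shows that shifting never enlarges the shadow. The cases follow the added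
    point [z]; when it is neither [x] nor [y], adding it commutes with the swap. *)
Lemma shadow_shift F : shadow (shift F) \subset shift (shadow F).
Proof.
have sh z B : z \notin B -> z |: B \in F -> B \in shadow F.
  by move=> zB h; apply/shadowP; exists z.
have swN z B : z != x -> z != y -> z \notin B -> z \notin sw B.
  by move=> zx zy; rewrite inE tpermD // eq_sym.
apply/subsetP => B /shadowP[z zB]; rewrite !shiftE !in_setU1.
case: (eqVneq z x) zB => [->|zx] zB.
  rewrite ?eqxx (negPf zB) /= [y == x]eq_sym (negPf xy) /=.
  case yB: (y \in B) => /=.
    rewrite orbF => h.
    (* Here [B] contains [y] but not [x], so both [B] and its swap must lie in the shadow; the
       single member [x |: B] of [F] yields both. *)
    have e : y |: sw B = x |: B.
      apply/setP => t; rewrite !inE; case: tpermP => [->|->|/eqP tx /eqP ty].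
      - by rewrite eqxx yB orbT.
      - by rewrite eqxx yB orbT.
      - by rewrite (negPf tx) (negPf ty).
    rewrite (sh _ _ zB h) /=.
    by apply: (sh y); rewrite ?e // inE tpermR.
  rewrite andbT => /orP[/(sh _ _ zB)//|].
  by rewrite swU1l ?yB // => /(sh _ _ (negbT yB)).
case: (eqVneq z y) zB => [->|zy] zB.
  rewrite (negPf zB) /=.
  case xB: (x \in B) => /=; last by case/andP => /(sh _ _ zB) ->.
  by rewrite orbF => /(sh _ _ zB) ->.
rewrite /= swU1 //.
case: (x \in B) => /=.
  case/orP => [/(sh _ _ zB) -> //|/andP[->] /sh -> //]; rewrite ?orbT //.
  exact: swN.
case/andP => /(sh _ _ zB) -> /implyP h; apply/implyP => /h.
by apply: sh; apply: swN.
Qed.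

Lemma shift_ksets S k F : x \in S -> y \in S ->
  F \subset ksets S k -> shift F \subset ksets S k.
Proof.
move=> xS yS /subsetP FS.
have swS A : sw A \in F -> A \in ksets S k.
  move/FS; rewrite !in_ksets => /andP[/subsetP AS].
  have -> : #|sw A| = #|A| by apply: card_preimset; apply: perm_inj.
  move=> ->; rewrite andbT; apply/subsetP => z zA.
  have := AS (tperm x y z); rewrite inE tpermK => /(_ zA).
  by case: tpermP => [->|->|].
apply/subsetP => A; rewrite inE; case: ifP => _; first by case/orP => [/FS|/swS].
by case: ifP => _; [case/andP => /FS|move/FS].
Qed.

End Shift.
(** As long as the inclusion fails, there are [B] and [y] with [y |: B] in [F] and [x |: B] outside
    [F]. Shifting [y] to [x] then removes [y |: B] and adds no member avoiding [x], so [#|del x F|]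
    decreases and the process stops. *)
Lemma shift_toward x S k F : x \in S -> F \subset ksets S k ->
  exists F', [/\ F' \subset ksets S k, #|F'| = #|F|,
    #|shadow F'| <= #|shadow F| & shadow (del x F') \subset link x F'].
Proof.
move=> xS; have [N] := ubnP #|del x F|; elim: N F => // N IHN F hN FS.
case: (boolP (shadow (del x F) \subset link x F)) => [h|]; first by exists F.
case/subsetPn => B /shadowP[y yB]; rewrite !inE negb_or.
case/andP => yF /andP[xy xB]; rewrite xB /= => xF.
have yS : y \in S.
  by move/subsetP: FS => /(_ _ yF); rewrite inE subUset sub1set => /andP[/andP[]].
have [||F' [h1 h2 h3 h4]] := IHN (shift x y F).
- apply: leq_trans (_ : #|del x F| <= N); last by rewrite -ltnS.
  apply: proper_card; apply/properP; split.
    apply/subsetP => A; rewrite inE => /andP[+ xA].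
    by rewrite shiftE // (negPf xA) => /andP[AF _]; rewrite inE AF.
  exists (y |: B); first by rewrite !inE yF negb_or xy.
  rewrite inE shiftE // !in_setU1 eqxx (negPf xy) (negPf xB) /= yF.
  suff -> : [set z | tperm x y z \in y |: B] = x |: B by rewrite (negPf xF).
  rewrite -(swU1l xB yB); apply/setP => z.
  by rewrite !inE tpermK.
- exact: shift_ksets.
exists F'; split => //; first by rewrite h2 card_shift.
apply: leq_trans h3 _; rewrite -(card_shift x y (shadow F)).
exact/subset_leq_card/shadow_shift.
Qed.

(** Induction on the ground set. After shifting toward [x], the inclusion of [shadow (del x F')] in
    [link x F'] and the bound for the deletion give the hypothesis of [kk_shifted]. *)
Theorem kruskal_katona S k F : F \subset ksets S k -> kk #|S| k #|F| <= #|shadow F|.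
Proof.
move: {2}#|S| (erefl #|S|) => m; elim: m S k F => [|m IHm] S [|k] F Sm.
- by rewrite Sm.
- by rewrite Sm.
- by rewrite kk0k.
move=> FS; have [x xS] : exists x, x \in S by apply/card_gt0P; rewrite Sm.
have [F' [FS' <- hsh hx]] := shift_toward xS FS.
apply: leq_trans hsh; rewrite (card_shadow x) (card_link_del x) Sm.
have Sx : #|S :\ x| = m by have := cardsD1 x S; rewrite xS Sm; lia.
have FD := del_ksets x FS'; have FL := link_ksets x FS'.
have h0 := IHm _ _ _ Sx FD; have h1 := IHm _ _ _ Sx FL.
have c0 := subset_leq_card FD; have c1 := subset_leq_card FL.
rewrite !card_ksets Sx in h0 h1 c0 c1.
have := kk_shifted c0 c1 (leq_trans h0 (subset_leq_card hx)).
have /subset_leq_card : link x F' \subset shadow (del x F') :|: link x F'.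
  exact: subsetUr.
lia.
Qed.

(** * Initial colexicographic segments *)

(* The head of e is the largest element. *)
Fixpoint colex (e : seq T) k : seq {set T} :=
  match k, e with
  | 0, _ => [:: set0]
  | k'.+1, [::] => [::]
  | k'.+1, x :: e' => colex e' k ++ [seq x |: A | A <- colex e' k']
  end.

Lemma colex0 e : colex e 0 = [:: set0].
Proof. by case: e. Qed.

Lemma size_colex e k : size (colex e k) = 'C(size e, k).
Proof.
elim: e k => [|x e IHe] [|k] //=.
by rewrite size_cat size_map !IHe binS.
Qed.

Lemma mem_colex e k A : uniq e ->
  (A \in colex e k) = (A \subset [set:: e]) && (#|A| == k).
Proof.
elim: e k A => [|x e IHe] [|k] A /=.
- move=> _; rewrite cards_eq0 inE; case: eqP => [->|_]; rewrite ?sub0set ?andbF //.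
- move=> _; rewrite in_nil; case: (A =P set0) => [->|A0].
    by rewrite cards0 andbF.
  by rewrite set_nil subset0; case: eqP A0.
- move=> _; rewrite cards_eq0 inE; case: eqP => [->|_]; rewrite ?sub0set ?andbF //.
case/andP => xe ue; rewrite mem_cat set_cons IHe //.
case: (boolP (x \in A)) => xA.
  have -> : (A \subset [set:: e]) = false.
    apply/negbTE/negP => /subsetP /(_ _ xA).
    by rewrite inE (negPf xe).
  rewrite /= -subDset (cardsD1 x A) xA add1n eqSS.
  rewrite -(IHe k) //; apply/mapP/idP => [[B Be ->]|h].
    have xB : x \notin B.
      move: Be; rewrite IHe // => /andP[/subsetP BS _].
      by apply/negP => /BS; rewrite inE (negPf xe).
    by rewrite setU1K.
  by exists (A :\ x); rewrite ?setD1K.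
have -> : (A \in [seq x |: A0 | A0 <- colex e k]) = false.
  by apply/negbTE/mapP => -[B _ e1]; rewrite e1 setU11 in xA.
rewrite orbF; congr (_ && _); apply/idP/idP => /subsetP h; apply/subsetP => y yA.
  by rewrite inE h ?orbT.
by have := h _ yA; rewrite in_setU1 => /predU1P[e1|//]; rewrite -e1 yA in xA.
Qed.

Lemma uniq_colex e k : uniq e -> uniq (colex e k).
Proof.
elim: e k => [|x e IHe] [|k] //= /andP[xe ue].
have xN j B : B \in colex e j -> x \notin B.
  rewrite mem_colex // => /andP[/subsetP BS _].
  by apply/negP => /BS; rewrite inE (negPf xe).
rewrite cat_uniq IHe //= map_inj_in_uniq ?IHe ?andbT //.
  apply/hasPn => A /mapP[B _ ->]; apply/negP => /xN.
  by rewrite setU11.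
move=> B C /xN xB /xN xC e1.
by rewrite -(setU1K xB) -(setU1K xC) e1.
Qed.

Definition colex_seg e k s : {set {set T}} := [set:: take s (colex e k)].

Lemma colex_seg_sub e k s t : s <= t -> colex_seg e k s \subset colex_seg e k t.
Proof.
move=> st; apply/subsetP => A; rewrite !inE.
by rewrite -(subnKC st) takeD mem_cat => ->.
Qed.

Lemma card_colex_seg e k s : uniq e -> s <= 'C(size e, k) ->
  #|colex_seg e k s| = s.
Proof.
move=> ue h; rewrite cardsE (card_uniqP _) ?take_uniq ?uniq_colex //.
by rewrite size_takel // size_colex.
Qed.

Lemma colex_seg_ksets e k s : uniq e -> colex_seg e k s \subset ksets [set:: e] k.
Proof.
move=> ue; apply/subsetP => A; rewrite inE => /mem_take.
by rewrite mem_colex // inE.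
Qed.

Lemma colex_seg_notin x e k s : uniq (x :: e) ->
  {in colex_seg e k s, forall A, x \notin A}.
Proof.
move=> /= /andP[xe ue] A /(subsetP (colex_seg_ksets _ _ ue)).
by rewrite inE => /andP[/subsetP Ae _]; apply/negP => /Ae; rewrite inE (negPf xe).
Qed.

Lemma colex_seg_full e k s : uniq e -> 'C(size e, k) <= s ->
  colex_seg e k s = ksets [set:: e] k.
Proof.
move=> ue h; apply/setP => A; rewrite !inE take_oversize ?size_colex //.
exact: mem_colex.
Qed.

(** With [colex_seg_small], this matches initial segments with the two branches of [kk]. *)
Lemma colex_seg_large x e k s : uniq (x :: e) -> 'C(size e, k.+1) <= s ->
  colex_seg (x :: e) k.+1 s =
  ksets [set:: e] k.+1 :|: 
  [set x |: A | A in colex_seg e k (s - 'C(size e, k.+1))].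
Proof.
move=> /= /andP[xe ue] h; rewrite -(@colex_seg_full _ _ s ue h).
apply/setP => A; rewrite !inE /= take_cat size_colex ltnNge h /= mem_cat.
rewrite [take s (colex e k.+1)]take_oversize ?size_colex //; congr (_ || _).
rewrite -map_take; apply/mapP/imsetP => -[B BB ->]; exists B => //.
  by rewrite inE.
by rewrite inE in BB.
Qed.

Lemma colex_seg_small x e k s : s <= 'C(size e, k) ->
  colex_seg (x :: e) k s = colex_seg e k s.
Proof.
case: k => [|k] h; first by rewrite /colex_seg !colex0.
by rewrite /colex_seg /= takel_cat // size_colex.
Qed.

Lemma shadowU F F' : shadow (F :|: F') = shadow F :|: shadow F'.
Proof.
apply/setP => B; rewrite in_setU; apply/shadowP/orP => [[x xB]|].
  by rewrite inE => /orP[] h; [left|right]; apply/shadowP; exists x.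
by case=> /shadowP[x xB h]; exists x; rewrite // inE h ?orbT.
Qed.

Lemma shadow_ksets S k : shadow (ksets S k.+1) \subset ksets S k.
Proof.
apply/subsetP => B /shadowP[x xB]; rewrite !inE subUset cardsU1 xB.
by case/andP=> /andP[_ ->]; rewrite add1n eqSS.
Qed.

Lemma shadow_imU1 x F : {in F, forall A, x \notin A} ->
  shadow [set x |: A | A in F] \subset F :|: [set x |: A | A in shadow F].
Proof.
move=> xF; apply/subsetP => B /shadowP[y yB /imsetP[C CF e]]; rewrite in_setU.
have xC := xF _ CF; case: (boolP (x \in B)) => xB; last first.
  have xy : x = y.
    by have := setU11 x C; rewrite -e in_setU1 (negPf xB) orbF => /eqP.
  by rewrite -(setU1K xB) [in x |: B]xy e setU1K // CF.
apply/orP; right; apply/imsetP; exists (B :\ x); last by rewrite setD1K.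
have yx : y != x by apply: contraNneq yB => ->.
apply/shadowP; exists y; first by rewrite !inE (negPf yB) andbF.
suff -> : y |: (B :\ x) = C by [].
rewrite -(setU1K xC) -e; apply/setP => z; rewrite !inE.
by case: (eqVneq z y) => [->|]; rewrite ?yx.
Qed.

(** Sharpness of [kruskal_katona]: initial segments attain the bound. Containment in a segment,
    rather than a mere count, is what later lets two such shadows be compared by inclusion. *)
Lemma shadow_colex_seg e k s : uniq e ->
  shadow (colex_seg e k.+1 s) \subset colex_seg e k (kk (size e) k.+1 s).
Proof.
elim: e k s => [|x e IHe] k s; first by case: k => [|k] _;
  apply/subsetP => A /shadowP[y _]; rewrite inE.
move=> uxe; have /= /andP[xe ue] := uxe.
case: (leqP s 'C(size e, k.+1)) => hs.
  rewrite !colex_seg_small ?kk_ub //; exact: IHe.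
set s' := s - _; set t := _ + _.
(* The target segment is long enough to contain every [k]-subset avoiding [x], so only the sets
   containing [x] remain to be treated. *)
have full : ksets [set:: e] k \subset colex_seg (x :: e) k t.
  rewrite -(@colex_seg_full e k 'C(size e, k)) // -(colex_seg_small x) //.
  exact/colex_seg_sub/leq_addr.
rewrite (colex_seg_large uxe (ltnW hs)) shadowU subUset.
rewrite (subset_trans (shadow_ksets _ _) full) /=.
apply: subset_trans (shadow_imU1 (colex_seg_notin uxe)) _; rewrite subUset.
rewrite (subset_trans (colex_seg_ksets _ _ ue) full) /=.
(* For [k = 0] the link contains at most the empty set, whose shadow is empty. *)
case: k @s' @t full hs => [|k] s' t full hs.
  apply/subsetP => B /imsetP[C /shadowP[y _]].
  rewrite inE colex0 => /mem_take; rewrite inE => /eqP/setP/(_ y).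
  by rewrite setU11 inE.
rewrite colex_seg_large ?leq_addr //; apply: subset_trans (subsetUr _ _).
by rewrite /t addKn; apply: imsetS; apply: IHe.
Qed.

End Families.

(** * Inequalities for [kk] of a sum, from explicit families *)

Lemma kk_widen m n k s : s <= 'C(n, k) -> kk (m + n) k s = kk n k s.
Proof.
move=> h; elim: m => // m IHm; rewrite addSn kk_small //.
by apply: leq_trans h _; rewrite leq_bin2l // leq_addl.
Qed.

Lemma card_shadow_colex_seg (T : finType) (e : seq T) k s : uniq e ->
  #|shadow (colex_seg e k s)| <= kk (size e) k s.
Proof.
case: k => [|k] ue.
  rewrite kk0k leqn0 cards_eq0; apply/eqP/setP => B; rewrite [RHS]inE.
  apply/negP => /shadowP[x _ /(subsetP (colex_seg_ksets _ _ ue))].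
  by rewrite inE cards_eq0 => /andP[_ /eqP/setP/(_ x)]; rewrite setU11 inE.
apply: leq_trans (subset_leq_card (shadow_colex_seg _ _ ue)) _.
rewrite card_colex_seg //; exact: kk_ub.
Qed.

(** Apply [kruskal_katona] to a family whose deletion and link at [x] are initial segments. The
    shadow of the deletion and the link then lie in segments of one order, so their union is no
    longer than the longer of the two; hence the maximum. *)
Lemma kk_add n k a b : a <= 'C(n, k.+1) -> b <= 'C(n, k) ->
  kk n.+1 k.+1 (a + b) <= maxn (kk n k.+1 a) b + kk n k b.
Proof.
move=> ha hb; have := enum_uniq 'I_n.+1; have := size_enum_ord n.+1.
case: (enum 'I_n.+1) => [//|x e] [se] uxe; have /= /andP[xe ue] := uxe.
pose P := colex_seg e k.+1 a; pose Q := colex_seg e k b.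
pose F := P :|: [set x |: B | B in Q].
have xN j s := @colex_seg_notin _ x e j s uxe.
have dF : del x F = P.
  apply/setP => A; rewrite inE in_setU; apply/andP/idP => [[/orP[//|]]|AP].
    by case/imsetP => B _ ->; rewrite setU11.
  by rewrite AP (xN _ _ _ AP).
have lF : link x F = Q.
  apply/setP => A; rewrite inE in_setU; apply/andP/idP => [[xA /orP[/xN|]]|AQ].
  - by rewrite setU11.
  - by case/imsetP => B BQ e1; rewrite -(setU1K xA) e1 setU1K ?(xN _ _ _ BQ).
  - by rewrite (xN _ _ _ AQ); split => //; rewrite imset_f ?orbT.
have FS : F \subset ksets [set: 'I_n.+1] k.+1.
  rewrite subUset; apply/andP; split; apply/subsetP => A.
    move/(subsetP (colex_seg_ksets _ _ ue)); rewrite !inE subsetT.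
    by case/andP.
  case/imsetP => B BQ ->; rewrite inE subsetT cardsU1 (xN _ _ _ BQ) /=.
  move/(subsetP (colex_seg_ksets _ _ ue)): BQ; rewrite !inE.
  by case/andP => _ /eqP ->.
have := kruskal_katona FS; rewrite (card_shadow x) (card_link_del x) dF lF.
rewrite cardsT card_ord !card_colex_seg ?se // => h.
apply: leq_trans h _; apply: leq_add; last first.
  by rewrite -[in leqRHS]se; apply: card_shadow_colex_seg.
have /subset_leq_card : shadow P :|: Q \subset
    colex_seg e k (maxn (kk n k.+1 a) b).
  rewrite subUset; apply/andP; split; last exact/colex_seg_sub/leq_maxr.
  apply: subset_trans (colex_seg_sub _ _ (leq_maxl _ _)).
  by rewrite -[in kk _ _ _]se; apply: shadow_colex_seg.
by rewrite card_colex_seg // se geq_max kk_ub.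
Qed.

Lemma card_shadow_imset (T U : finType) (f : T -> U) (F : {set {set T}}) :
  injective f -> #|shadow [set f @: A | A : {set T} in F]| <= #|shadow F|.
Proof.
move=> fi; apply: leq_trans (leq_imset_card (fun A : {set T} => f @: A) _).
apply: subset_leq_card; apply/subsetP => B /shadowP[u uB /imsetP[A AF e]].
have : u \in f @: A by rewrite -e setU11.
case/imsetP => a aA ua; apply/imsetP; exists (A :\ a).
  by apply/shadowP; exists a; rewrite ?setD11 ?setD1K.
rewrite -(setU1K uB) e ua; apply/setP => v; rewrite !inE.
apply/andP/imsetP => [[va /imsetP[t tA e1]]|[t]].
  by exists t => //; rewrite !inE tA andbT -(inj_eq fi) -e1.
by rewrite !inE => /andP[ta tA] ->; rewrite (inj_eq fi) imset_f.
Qed.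

(* Two initial segments are glued into one family over bool * 'I_n so that they
   are disjoint but their shadows meet. *)
Lemma kk_add_lt n k p q : 0 < p -> 0 < q -> p + q <= 'C(n, k.+1) ->
  kk n k.+1 (p + q) < kk n k.+1 p + kk n k.+1 q.
Proof.
move=> p0 q0 hpq; pose e := enum 'I_n; have ue : uniq e by apply: enum_uniq.
have se : size e = n by apply: size_enum_ord.
pose A0 := head set0 (colex e k.+1).
have A0in s : 0 < s -> A0 \in colex_seg e k.+1 s.
  have := size_colex e k.+1; rewrite inE /A0 se; case: s => // s.
  case: (colex e k.+1) => [|A r] /=; last by rewrite inE eqxx.
  by lia.
have cA0 : #|A0| = k.+1.
  have /(subsetP (colex_seg_ksets _ _ ue)) := A0in _ p0.
  by rewrite inE => /andP[_ /eqP].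
have [a aA] : exists a, a \in A0 by apply/card_gt0P; rewrite cA0.
pose c := A0 :\ a; have cc : #|c| = k.
  by have := cardsD1 a A0; rewrite aA cA0 -/c; lia.
(* The maps agree exactly on [c], which has [k] elements. An image under both would come from a
   [k.+1]-set inside [c], so the two families are disjoint, while the image of [c] lies in both
   shadows. *)
pose f (t : 'I_n) := (true, t); pose g (t : 'I_n) := (t \in c, t).
have fi : injective f by move=> t u [].
have gi : injective g by move=> t u [].
pose P := [set f @: A | A : {set 'I_n} in colex_seg e k.+1 p].
pose Q := [set g @: A | A : {set 'I_n} in colex_seg e k.+1 q].
have kP : P \subset ksets setT k.+1.
  apply/subsetP => B /imsetP[A + ->]; rewrite in_ksets subsetT card_imset //.
  by move/(subsetP (colex_seg_ksets _ _ ue)); rewrite inE => /andP[].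
have kQ : Q \subset ksets setT k.+1.
  apply/subsetP => B /imsetP[A + ->]; rewrite in_ksets subsetT card_imset //.
  by move/(subsetP (colex_seg_ksets _ _ ue)); rewrite inE => /andP[].
have cP : #|P| = p.
  rewrite card_imset; last exact: imset_inj.
  by rewrite card_colex_seg // se; lia.
have cQ : #|Q| = q.
  rewrite card_imset; last exact: imset_inj.
  by rewrite card_colex_seg // se; lia.
have PQ : P :&: Q = set0.
  apply/setP => B; rewrite [RHS]inE; apply/negP => /setIP[/imsetP[A _ ->]].
  case/imsetP => C /(subsetP (colex_seg_ksets _ _ ue)).
  rewrite inE => /andP[_ /eqP cC] e1.
  have /subset_leq_card : C \subset c.
    apply/subsetP => t tC; have : g t \in f @: A by rewrite e1 imset_f.
    by case/imsetP => u _ [].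
  by rewrite cC cc ltnn.
have cI : f @: c \in shadow P :&: shadow Q.
  rewrite inE; apply/andP; split; apply/shadowP.
    exists (f a); first by rewrite mem_imset // setD11.
    apply/imsetP; exists A0; first exact: A0in.
    by rewrite -imsetU1 setD1K.
  have -> : f @: c = g @: c.
    by apply: eq_in_imset => t tc; rewrite /f /g tc.
  exists (g a); first by rewrite mem_imset // setD11.
  apply/imsetP; exists A0; first exact: A0in.
  by rewrite -imsetU1 setD1K.
have := @kruskal_katona _ setT k.+1 (P :|: Q).
rewrite subUset kP kQ => /(_ isT).
rewrite cardsU PQ cards0 subn0 cP cQ cardsT card_prod card_bool card_ord mul2n.
(* The glued ground set has [n + n] points, but the size [p + q] already fits in [n] points, so [kk]
   is unchanged. *)
rewrite -addnn kk_widen //.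
have := cardsUI (shadow P) (shadow Q); rewrite -shadowU.
have : 0 < #|shadow P :&: shadow Q| by apply/card_gt0P; exists (f @: c).
have hP : #|shadow P| <= kk n k.+1 p.
  by rewrite -[X in kk X _ _]se; apply: leq_trans (card_shadow_imset _ fi) _;
    exact: (card_shadow_colex_seg _ _ ue).
have hQ : #|shadow Q| <= kk n k.+1 q.
  by rewrite -[X in kk X _ _]se; apply: leq_trans (card_shadow_imset _ gi) _;
    exact: (card_shadow_colex_seg _ _ ue).
move=> h1 h2 h3; apply: leq_ltn_trans h3 _.
by rewrite -(ltn_add2r #|shadow P :&: shadow Q|) h2; lia.
Qed.

(** * Families of minimum shadow *)

Section MinShadow.
Variable T : finType.
Implicit Types (A B S : {set T}) (F : {set {set T}}) (x y z : T).

Definition uncovered x F := [forall A in F, x \notin A].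

Lemma uncoveredP x F : reflect {in F, forall A, x \notin A} (uncovered x F).
Proof. exact: forall_inP. Qed.

Lemma uncovered_link_del x z F : z != x ->
  uncovered z (link x F) -> uncovered z (del x F) -> uncovered z F.
Proof.
move=> zx /uncoveredP zL /uncoveredP zD; apply/uncoveredP => A AF.
case: (boolP (x \in A)) => xA; last by apply: zD; rewrite inE AF.
have := zL (A :\ x); rewrite !inE eqxx setD1K // => /(_ AF).
by rewrite zx.
Qed.

Lemma uncovered_sub z F F' : F \subset F' -> uncovered z F' -> uncovered z F.
Proof.
move=> /subsetP FF /uncoveredP h; apply/uncoveredP => A /FF; exact: h.
Qed.

(** Members have at least two elements, so a covered point survives the removal of some other
    point. *)
Lemma uncovered_shadow z S k F : F \subset ksets S k.+2 ->
  uncovered z F = uncovered z (shadow F).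
Proof.
move=> /subsetP FS; apply/uncoveredP/uncoveredP => h A.
  by case/shadowP => y _ /h; rewrite in_setU1 negb_or => /andP[].
move=> AF; apply/negP => zA.
have cA : #|A| = k.+2 by have := FS _ AF; rewrite inE => /andP[_ /eqP].
have /card_gt0P[y yA] : 0 < #|A :\ z|.
  by have := cardsD1 z A; rewrite zA cA; lia.
move: yA; rewrite !inE => /andP[yz yA].
have : A :\ y \in shadow F by apply/shadowP; exists y; rewrite ?setD11 ?setD1K.
by move/h; rewrite !inE zA andbT eq_sym yz.
Qed.

(* For any x in S, comparing |shadow F| with kk_add forces the link and the
   deletion of x to be extremal and nested, so that a point left uncovered by
   one of them (by induction) is left uncovered by both; the exceptional sizes
   contradict kk_ub or the strict inequality kk_add_lt. *)
Theorem min_shadow_uncovered m S k F : #|S| = m.+1 -> F \subset ksets S k ->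
  #|F| <= 'C(m, k) -> #|shadow F| <= kk m.+1 k #|F| ->
  exists2 x, x \in S & uncovered x F.
Proof.
elim: m S k F => [|m IHm] S k F Sm FS cF hF.
  have [x xS] : exists x, x \in S by apply/card_gt0P; rewrite Sm.
  exists x => //; apply/uncoveredP => A AF.
  case: k FS cF {hF} => [|k] /subsetP FS.
    by have := FS _ AF; rewrite inE cards_eq0 => /andP[_ /eqP ->]; rewrite inE.
  rewrite bin0n leqn0 cards_eq0 => /eqP F0.
  by rewrite F0 inE in AF.
have [x xS] : exists x, x \in S by apply/card_gt0P; rewrite Sm.
case: k FS cF hF => [|[|k]] FS cF hF.
- exists x => //; apply/uncoveredP => A /(subsetP FS).
  by rewrite inE cards_eq0 => /andP[_ /eqP ->]; rewrite inE.
(* Singletons are treated directly, since [uncovered_shadow] fails for them: at most [m.+1]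
   singletons cannot cover [m.+2] points. *)
- case: (boolP [exists y in S, [set y] \notin F]) => [|h].
    case/existsP => y /andP[yS yF]; exists y => //; apply/uncoveredP => A AF.
    have := subsetP FS _ AF; rewrite inE => /andP[_ /cards1P[z Az]].
    rewrite Az inE; apply: contraNneq yF => ->.
    by rewrite -Az.
  have : [set [set y] | y in S] \subset F.
    apply/subsetP => A /imsetP[y yS ->]; apply/negPn; apply: contraNN h => yF.
    by apply/existsP; exists y; rewrite yS.
  move/subset_leq_card; rewrite card_imset ?Sm; last exact: set1_inj.
  by rewrite bin1 in cF => /leq_trans/(_ cF); rewrite ltnn.
have Sx : #|S :\ x| = m.+1 by have := cardsD1 x S; rewrite xS Sm; lia.
have SxS y : y \in S :\ x -> y \in S by rewrite inE => /andP[].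
have FD := del_ksets x FS; have FL := link_ksets x FS.
have hD := kruskal_katona FD; have hL := kruskal_katona FL.
have cD := subset_leq_card FD; have cL := subset_leq_card FL.
rewrite !card_ksets Sx in hD hL cD cL.
have cF' := card_link_del x F; rewrite cF' in cF hF.
have hU := kk_add cD cL; have := card_shadow x F.
have subD : #|shadow (del x F)| <= #|shadow (del x F) :|: link x F|.
  exact/subset_leq_card/subsetUl.
have subL : #|link x F| <= #|shadow (del x F) :|: link x F|.
  exact/subset_leq_card/subsetUr.
move=> hs; have hs' : #|shadow F| <= kk m.+1 k.+2 (#|del x F| + #|link x F|).
  by rewrite -kk_small.
have [L0|L0] := posnP #|link x F|.
  exists x => //; apply/uncoveredP => A AF; apply/negP => xA.
  move/eqP: L0; rewrite cards_eq0 => /eqP/setP/(_ (A :\ x)).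
  by rewrite !inE eqxx setD1K // AF.
(* Too large a link would give [F] a shadow of more than ['C(m, k.+1) + 'C(m, k)] sets, above the
   upper bound for [kk]. *)
case: (leqP #|link x F| 'C(m, k.+1)) => [hb|hb]; last first.
  exfalso; have := kk_ub m.+1 k.+1 (#|del x F| + #|link x F|).
  by have := kk_large hb; rewrite binS; lia.
(* Both summands of [#|shadow F|] are at least the matching terms of [kk_add], and their sum is at
   most the sum of those terms; hence each is equal to its term. *)
have eqL : #|shadow (link x F)| <= kk m.+1 k.+1 #|link x F| by lia.
have eqU : #|shadow (del x F) :|: link x F| <=
  maxn (kk m.+1 k.+2 #|del x F|) #|link x F| by lia.
(* For a large deletion, removing the full layer ['C(m, k.+2)] from both [#|del x F|] and the total
   leaves sizes to which the strict [kk_add_lt] applies, contradicting minimality. *)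
case: (leqP #|del x F| 'C(m, k.+2)) => [ha|ha]; last first.
  exfalso; rewrite binS in cF.
  have := kk_large ha; have := kk_small hb.
  have := @kk_large m k.+1 (#|del x F| + #|link x F|).
  have := @kk_add_lt m k (#|del x F| - 'C(m, k.+2)) #|link x F|.
  have -> : #|del x F| - 'C(m, k.+2) + #|link x F| =
    #|del x F| + #|link x F| - 'C(m, k.+2) by lia.
  by lia.
(* By [eqU], the larger of [shadow (del x F)] and [link x F] contains the other, so induction is
   applied to the family behind the larger one. *)
case: (leqP (kk m.+1 k.+2 #|del x F|) #|link x F|) => hab.
  have [y ySx yL] := IHm _ _ _ Sx FL hb eqL.
  exists y; first exact: SxS.
  have yx : y != x by move: ySx; rewrite !inE => /andP[].
  apply: (uncovered_link_del yx yL); rewrite (uncovered_shadow _ FD).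
  apply: uncovered_sub yL.
  have /eqP <- : shadow (del x F) :|: link x F == link x F.
    rewrite eq_sym eqEcard subsetUr; apply: leq_trans eqU _.
    by rewrite geq_max hab leqnn.
  exact: subsetUl.
have eqD : #|shadow (del x F)| <= kk m.+1 k.+2 #|del x F| by lia.
have [y ySx yD] := IHm _ _ _ Sx FD ha eqD.
exists y; first exact: SxS.
have yx : y != x by move: ySx; rewrite !inE => /andP[].
apply: (uncovered_link_del yx _ yD).
rewrite (uncovered_shadow _ FD) in yD; apply: uncovered_sub yD.
have /eqP <- : shadow (del x F) :|: link x F == shadow (del x F).
  by rewrite eq_sym eqEcard subsetUl; lia.
exact: subsetUr.
Qed.

(** * Complements, lex segments and removal of a variable *)

Definition cmpl S F : {set {set T}} := [set S :\: A | A in F].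

(** The order is a list, largest variable first, so that the induction can simply prepend a
    variable. *)
Definition lexgt (e : seq T) B A := [exists i, [&& i \in B, i \notin A &
  [forall j, (index j e < index i e) ==> ((j \in B) == (j \in A))]]].

(** For families of [k]-subsets of [S], [kruskal_katona] gives the reverse inequality, so this
    expresses minimality of the shadow. *)
Definition opt_shadow S k F := #|shadow F| <= kk #|S| k #|F|.

Definition lexseg S d F := exists2 e : seq T, uniq e /\ e =i S &
  forall A B, A \in F -> B \in ksets S d -> lexgt e B A -> B \in F.

Lemma mem_cmpl S k F B : F \subset ksets S k ->
  (B \in cmpl S F) = (B \subset S) && (S :\: B \in F).
Proof.
move/subsetP => FS; apply/imsetP/andP => [[A AF ->]|[BS h]].
  have := FS _ AF; rewrite inE => /andP[AS _].
  by rewrite subsetDl setDDr setDv set0U (setIidPr AS).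
by exists (S :\: B); rewrite // setDDr setDv set0U (setIidPr BS).
Qed.

Lemma card_cmpl S k F : F \subset ksets S k -> #|cmpl S F| = #|F|.
Proof.
move/subsetP => FS; apply: card_in_imset => A B /FS + /FS.
rewrite !inE => /andP[AS _] /andP[BS _] e.
have : S :\: (S :\: A) = S :\: (S :\: B) by rewrite e.
by rewrite !setDDr setDv !set0U (setIidPr AS) (setIidPr BS).
Qed.

Lemma cmpl_ksets S k F : F \subset ksets S k -> cmpl S F \subset ksets S (#|S| - k).
Proof.
move/subsetP => FS; apply/subsetP => B /imsetP[A /FS + ->].
rewrite !inE => /andP[AS /eqP cA].
by rewrite subsetDl cardsD (setIidPr AS) cA eqxx.
Qed.

Lemma cmplK S k F : F \subset ksets S k -> cmpl S (cmpl S F) = F.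
Proof.
move=> FS; apply/setP => A; rewrite (mem_cmpl _ (cmpl_ksets FS)).
rewrite (mem_cmpl _ FS) subsetDl.
apply/andP/idP => [[AS]|AF]; first by rewrite setDDr setDv set0U (setIidPr AS).
have := subsetP FS _ AF; rewrite inE => /andP[AS _].
by rewrite AS setDDr setDv set0U (setIidPr AS).
Qed.

Lemma cmplD S k F : k <= #|S| -> F \subset ksets S k ->
  cmpl S (ksets S k :\: F) = ksets S (#|S| - k) :\: cmpl S F.
Proof.
move=> kS FS; apply/setP => B.
rewrite (mem_cmpl _ (subsetDl _ _)) !in_setD (mem_cmpl _ FS) !in_ksets.
case BS : (B \subset S) => //=.
rewrite subsetDl cardsD (setIidPr BS) /=; congr (_ && _).
by have := subset_leq_card BS; lia.
Qed.

(** Complementing supports reverses the lex order, and passing to the nonmembers turns final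
    segments into initial ones; the same variable order serves both families. *)
Lemma lexseg_cmpl S d F : d <= #|S| -> F \subset ksets S d ->
  lexseg S (#|S| - d) (cmpl S (ksets S d :\: F)) -> lexseg S d F.
Proof.
move=> dS FS [e ue h]; exists e => // A B AF BS gt; apply/negPn/negP => BF.
have AS := subsetP FS _ AF.
have : S :\: A \in cmpl S (ksets S d :\: F).
  apply: (h (S :\: B)).
  - by apply: imset_f; rewrite inE BF.
  - by apply: (subsetP (cmpl_ksets FS)); apply: imset_f.
  case/existsP: gt => i /and3P[iB iA /forallP ij]; apply/existsP; exists i.
  have iS : i \in S by move: BS; rewrite inE => /andP[/subsetP /(_ _ iB)].
  rewrite !inE iA iB iS /=; apply/forallP => j; apply/implyP => ji.
  by have := ij j; rewrite ji !inE => /eqP ->.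
rewrite (mem_cmpl _ (subsetDl _ _)) subsetDl in_setD.
by move: AS; rewrite inE => /andP[AS _];
  rewrite setDDr setDv set0U (setIidPr AS) AF.
Qed.

(** With [x] placed first, a set lex-greater than a member must also contain [x], and the comparison
    takes place in the link. *)
Lemma lexseg_link S d F x : x \in S -> F \subset ksets S d.+1 ->
  {in F, forall A, x \in A} -> lexseg (S :\ x) d (link x F) -> lexseg S d.+1 F.
Proof.
move=> xS FS xF [e [ue eS] h]; exists (x :: e).
  split; first by rewrite /= ue eS !inE eqxx.
  by move=> y; rewrite inE eS !inE; case: eqVneq => // ->.
move=> A B AF BS /existsP[i /and3P[iB iA /forallP ij]].
have xA := xF _ AF; have ix : x != i by apply: contraTneq xA => ->.
have xB : x \in B.
  by have := ij x; rewrite /= eqxx (negPf ix) ltn0Sn xA => /eqP.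
suff : B :\ x \in link x F by rewrite !inE eqxx setD1K.
apply: (h (A :\ x)).
- by rewrite !inE eqxx setD1K.
- move: BS; rewrite !inE (cardsD1 x) xB add1n eqSS => /andP[BS ->].
  by rewrite andbT setSD.
apply/existsP; exists i; rewrite !inE eq_sym ix iB (negPf iA) andbF /=.
apply/forallP => j; apply/implyP => ji; rewrite !inE.
case: (eqVneq j x) => //= jx; have := ij j.
by rewrite /= eq_sym (negPf jx) (negPf ix) ltnS ji.
Qed.

(** Every [d.+1]-set avoiding [x] is a nonmember, and by the bound on [d] the shadow of these sets
    contains all [d]-sets avoiding [x]. This full layer cancels against the second branch of [kk],
    leaving the inequality for the link. *)
Lemma opt_del_lex S d F x : d < #|S|.-1 -> x \in S -> F \subset ksets S d.+1 ->
  {in F, forall A, x \in A} ->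
  opt_shadow S d.+1 (ksets S d.+1 :\: F) ->
  opt_shadow (S :\ x) d (ksets (S :\ x) d :\: link x F).
Proof.
set G := ksets S d.+1 :\: F => dS xS FS xF.
have Sx : #|S| = #|S :\ x|.+1 by rewrite (cardsD1 x) xS.
have dG : del x G = ksets (S :\ x) d.+1.
  apply/setP => A; rewrite inE in_setD !in_ksets subsetD1.
  case: (boolP (x \in A)) => xA; rewrite ?andbF //= !andbT.
  by case: (boolP (A \in F)) => // /xF; rewrite (negPf xA).
have lG : link x G = ksets (S :\ x) d :\: link x F.
  apply/setP => A; rewrite inE !in_setD !in_ksets subsetD1 [A \in link x F]inE.
  case: (boolP (x \in A)) => xA; rewrite ?andbF //= andbT.
  by rewrite subUset sub1set xS cardsU1 xA add1n eqSS.
have full : ksets (S :\ x) d \subset shadow (del x G).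
  rewrite dG; apply/subsetP => B; rewrite inE => /andP[BS /eqP cB].
  have /card_gt0P[y] : 0 < #|(S :\ x) :\: B|.
    by rewrite cardsD (setIidPr BS) cB; lia.
  rewrite inE => /andP[yB yS]; apply/shadowP; exists y => //.
  by rewrite inE subUset sub1set yS BS cardsU1 yB cB eqxx.
rewrite /opt_shadow -lG => h; have [L0|L0] := posnP #|link x G|.
  move/eqP: L0; rewrite cards_eq0 => /eqP ->.
  rewrite (_ : shadow set0 = set0) ?cards0 //; apply/setP => B; rewrite [RHS]inE.
  by apply/negP => /shadowP[y _]; rewrite inE.
have hG := card_link_del x G; rewrite dG card_ksets in hG.
have hs := card_shadow x G.
have := subset_leq_card (subset_trans full (subsetUl _ (link x G))).
rewrite card_ksets; move: h; rewrite hs Sx hG kk_large; last by lia.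
rewrite addKn => h1 h2; rewrite -(leq_add2l 'C(#|S :\ x|, d)).
by apply: leq_trans h1; rewrite leq_add2r.
Qed.

(** The complements all avoid [x], so the family stays the same and only the ground set shrinks;
    [kk_small] absorbs the change. *)
Lemma opt_cmpl_lex S d F x : x \in S -> F \subset ksets S d.+1 ->
  {in F, forall A, x \in A} ->
  opt_shadow S (#|S| - d.+1) (cmpl S F) ->
  opt_shadow (S :\ x) (#|S :\ x| - d) (cmpl (S :\ x) (link x F)).
Proof.
move=> xS FS xF.
have Sx : #|S| = #|S :\ x|.+1 by rewrite (cardsD1 x) xS.
have FL := link_ksets x FS.
have -> : cmpl S F = cmpl (S :\ x) (link x F).
  apply/setP => B; rewrite (mem_cmpl _ FS) (mem_cmpl _ FL).
  rewrite [_ \in link x F]inE subsetD1 -andbA.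
  have [BS|//] /= := boolP (B \subset S).
  have [xB|xB] /= := boolP (x \in B).
    by apply/negP => /xF; rewrite inE xB.
  rewrite !inE eqxx /= ; rewrite andbF /=; congr (_ \in F); apply/setP => y.
  rewrite !inE; case: eqVneq => [->|//].
  by rewrite xS xB.
rewrite /opt_shadow Sx subSS kk_small // (card_cmpl FL).
have [dle|dgt] := leqP d #|S :\ x|; last first.
  by apply: leq_trans (subset_leq_card FL) _; rewrite card_ksets bin_small.
by rewrite bin_sub // -card_ksets; apply: subset_leq_card.
Qed.

Theorem both_opt_lexseg S d F : d <= #|S| -> F \subset ksets S d ->
  opt_shadow S d (ksets S d :\: F) -> opt_shadow S (#|S| - d) (cmpl S F) ->
  lexseg S d F.
Proof.
move: {2}#|S| (erefl #|S|) => m; elim: m S d F => [|m IHm] S d F Sm dS FS.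
- move=> _ _; exists [::]; first (split=> //).
    by move/eqP: Sm; rewrite cards_eq0 => /eqP -> y; rewrite inE.
  move=> A B _ BS /existsP[i /andP[iB _]].
  move: BS; rewrite inE => /andP[/subsetP BS _].
  by move/eqP: Sm; rewrite cards_eq0 => /eqP S0; have := BS _ iB; rewrite S0 inE.
move=> hG hF.
(* Stated for arbitrary [d'] and [F'], as it serves both [F] and its Alexander dual. *)
have step x d' F' : x \in S -> 0 < d' -> d' < m.+1 -> F' \subset ksets S d' ->
    uncovered x (cmpl S F') -> opt_shadow S d' (ksets S d' :\: F') ->
    opt_shadow S (#|S| - d') (cmpl S F') -> lexseg S d' F'.
  case: d' => // d' xS _ dm FS' /uncoveredP xC h1 h2.
  have xF : {in F', forall A, x \in A}.
    move=> A AF; have := xC (S :\: A); rewrite imset_f // inE xS andbT negbK.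
    exact.
  have Sx : #|S :\ x| = m by have := cardsD1 x S; rewrite xS Sm; lia.
  apply: (lexseg_link xS FS' xF); apply: IHm => //.
  - by rewrite Sx; lia.
  - exact: link_ksets.
  - by apply: opt_del_lex h1 => //; rewrite Sm.
  - exact: opt_cmpl_lex h2.
case: (set_0Vmem F) => [->|[A0 A0F]].
  exists (enum S); last by move=> A B; rewrite inE.
  by split; [exact: enum_uniq|move=> y; rewrite mem_enum].
case: (set_0Vmem (ksets S d :\: F)) => [/eqP|[B0 B0G]].
  rewrite setD_eq0 => /subsetP h; exists (enum S) => [|A B _ /h//].
  by split; [exact: enum_uniq|move=> y; rewrite mem_enum].
have cFG : #|F| + #|ksets S d :\: F| = 'C(m.+1, d).
  by rewrite -Sm -card_ksets -(cardsID F (ksets S d)) (setIidPr FS).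
have F0 : 0 < #|F| by apply/card_gt0P; exists A0.
have G0 : 0 < #|ksets S d :\: F| by apply/card_gt0P; exists B0.
(* A member and a nonmember both exist, which excludes the degrees [0] and [m.+1] not covered by
   [step]. *)
have C2 : 1 < 'C(m.+1, d) by lia.
have d0 : 0 < d by case: (d) C2.
have dm : d < m.+1.
  rewrite ltn_neqAle -Sm dS andbT Sm; apply: contraTneq C2 => ->.
  by rewrite binn.
have GS := subsetDl (ksets S d) F.
(* By Pascal's rule and symmetry, the two thresholds ['C(m, m.+1 - d)] and ['C(m, d)] add up to
   ['C(m.+1, d)], so one of the two families meets its own. *)
case: (leqP #|F| 'C(m, m.+1 - d)) => hc.
  have [||x xS xU] := min_shadow_uncovered Sm (cmpl_ksets FS).
  - by rewrite Sm (card_cmpl FS).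
  - by move: hF; rewrite /opt_shadow Sm.
  exact: (step x).
have hc' : #|ksets S d :\: F| <= 'C(m, d).
  suff : 'C(m.+1, d) = 'C(m, d) + 'C(m, m.+1 - d) by lia.
  by case: (d) d0 dm => // c _ dm; rewrite subSS binS bin_sub // ltnW.
have [|x xS xU] := min_shadow_uncovered Sm GS hc'.
  by move: hG; rewrite /opt_shadow Sm.
(* Now [x] lies in every member of the Alexander dual, to which [step] applies with the two shadow
   hypotheses exchanged. *)
apply: lexseg_cmpl => //.
have dd : #|S| - (#|S| - d) = d by rewrite subKn.
have e1 : ksets S (#|S| - d) :\: cmpl S (ksets S d :\: F) = cmpl S F.
  rewrite (cmplD dS FS) setDDr setDv set0U; apply/setIidPr.
  exact: cmpl_ksets.
have e2 := cmplK GS.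
apply: (step x); rewrite ?e1 ?e2 ?dd //; try by rewrite Sm; lia.
exact: cmpl_ksets.
Qed.

End MinShadow.

(** * Monomial vector spaces *)

Section MonomialSpaces.
Variables (K : fieldType) (n : nat).
Implicit Types (A B : {set 'I_n}) (M N : {set {set 'I_n}}).
Import GRing.Theory.
Local Open Scope ring_scope.

Definition upper_shadow M : {set {set 'I_n}} :=
  [set B : {set 'I_n} | [exists j in B, B :\ j \in M]].

Lemma span_mono_eq0 (s : seq {set 'I_n}) (f : RR K n) A :
  f \in <<[seq mono K n B | B <- s]>>%VS -> A \notin s -> f A = 0.
Proof.
elim: s f => [|B s IHs] f /=.
  by rewrite span_nil memv0 => /eqP-> _; rewrite ffunE.
rewrite span_cons => /memv_addP[u /vlineP[c ->] [w ws ->]].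
rewrite inE negb_or => /andP[AB As].
by rewrite !ffunE (negPf AB) (IHs w) // addr0 scaler0.
Qed.

Lemma free_mono (s : seq {set 'I_n}) : uniq s -> free [seq mono K n B | B <- s].
Proof.
elim: s => [|B s IHs] /=; first by rewrite nil_free.
case/andP => Bs us; rewrite free_cons IHs // andbT.
apply/negP => /span_mono_eq0 /(_ Bs) /eqP.
by rewrite ffunE eqxx oner_eq0.
Qed.

Lemma dim_monvs M : \dim (monvs K n M) = #|M|.
Proof.
have := free_mono (enum_uniq (mem M)); rewrite /free => /eqP.
by rewrite /monvs size_map -cardE.
Qed.

Lemma mem_monvs M A : A \in M -> mono K n A \in monvs K n M.
Proof. by move=> AM; apply/memv_span/map_f; rewrite mem_enum. Qed.

Lemma mulx_mono j A :
  mulx K n j (mono K n A) = if j \in A then 0 else mono K n (j |: A).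
Proof.
rewrite lfunE /=; apply/ffunP => B; rewrite ffunE; case: ifP => jB; last first.
  case: ifP => jA; rewrite !ffunE //; case: eqP => // e.
  by rewrite e setU11 in jB.
rewrite ffunE; case: ifP => jA; rewrite ffunE.
  by case: eqP => // e; rewrite -e setD11 in jA.
congr (_%:R); congr nat_of_bool; apply/eqP/eqP => [<-|->].
  by rewrite setD1K.
by rewrite setU1K // jA.
Qed.

Lemma m1_monvs M : m1 K n (monvs K n M) = monvs K n (upper_shadow M).
Proof.
apply/eqP; rewrite eqEsubv; apply/andP; split.
  apply/subv_sumP => j _; rewrite limg_span; apply/span_subvP => v.
  case/mapP => w /mapP[A AM ->] ->; rewrite mulx_mono.
  case: ifP => jA; first exact: mem0v.
  apply: mem_monvs; rewrite inE; apply/existsP; exists j.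
  by rewrite setU11 setU1K ?jA // -mem_enum.
apply/span_subvP => v /mapP[B + ->]; rewrite mem_enum inE.
case/existsP => j /andP[jB BM].
apply: (subvP (sumv_sup j _ (subvv _))) => //.
have <- : mulx K n j (mono K n (B :\ j)) = mono K n B.
  by rewrite mulx_mono setD11 setD1K.
exact/memv_img/mem_monvs.
Qed.

(** Multiplying a monomial by a variable removes a point from the complement of its support. *)
Lemma card_shadow_cmpl k M : M \subset ksets [set: 'I_n] k ->
  #|shadow (cmpl [set: 'I_n] M)| = #|upper_shadow M|.
Proof.
move=> MS; rewrite -(card_imset _ (inv_inj (@setCK 'I_n))).
apply: eq_card => B; apply/imsetP/idP.
  case=> C /shadowP[x xC]; rewrite (mem_cmpl _ MS) setTD => /andP[_ h] ->.
  rewrite inE; apply/existsP; exists x; rewrite inE xC /=.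
  suff -> : ~: C :\ x = ~: (x |: C) by [].
  by rewrite setCU setDE setIC.
rewrite inE => /existsP[j /andP[jB h]]; exists (~: B); last by rewrite setCK.
apply/shadowP; exists j; first by rewrite inE jB.
rewrite (mem_cmpl _ MS) setTD subsetT /=.
suff -> : ~: (j |: ~: B) = B :\ j by [].
by rewrite setCU setCK setIC setDE.
Qed.

(** A single competitor is enough: the monomial space on the complements of a colex segment of the
    same size, whose shadow is bounded by [kk]. *)
Lemma Gotzmann_opt_shadow k N : (k <= n)%N -> N \subset ksets [set: 'I_n] k ->
  Gotzmann K n k (monvs K n N) ->
  opt_shadow [set: 'I_n] (n - k)%N (cmpl [set: 'I_n] N).
Proof.
move=> kn NS hG; pose e := enum 'I_n.
have ue : uniq e by apply: enum_uniq.
have se : size e = n by apply: size_enum_ord.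
have eT : [set:: e] = [set: 'I_n] by apply/setP => i; rewrite !inE mem_enum.
have cN : (#|N| <= 'C(n, n - k))%N.
  rewrite bin_sub //; apply: leq_trans (subset_leq_card NS) _.
  by rewrite card_ksets cardsT card_ord.
pose C := colex_seg e (n - k)%N #|N|.
have CS : C \subset ksets [set: 'I_n] (n - k)%N.
  by rewrite -eT; apply: colex_seg_ksets.
have CS' := cmpl_ksets CS; rewrite cardsT card_ord subKn // in CS'.
have cC : #|C| = #|N| by rewrite card_colex_seg // se.
have := hG (monvs K n (cmpl [set: 'I_n] C)).
rewrite !m1_monvs !dim_monvs (card_cmpl CS) cC => /(_ _ erefl) h.
rewrite /opt_shadow (card_cmpl NS) (card_shadow_cmpl NS) cardsT card_ord.
apply: leq_trans (h _) _.
  apply/span_subvP => v /mapP[A + ->]; rewrite mem_enum => /(subsetP CS').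
  rewrite inE subsetT /= => Ak.
  by apply/memv_span/map_f; rewrite mem_enum inE.
rewrite -(card_shadow_cmpl CS') (cmplK CS) -[X in kk X _ _]se.
exact: card_shadow_colex_seg.
Qed.

Lemma lexseg_is_lex_segment d M :
  lexseg [set: 'I_n] d M -> is_lex_segment n d M.
Proof.
case=> e [ue eT h]; have se : size e = n.
  rewrite -(card_uniqP ue) -[RHS]card_ord; apply: eq_card => i.
  by rewrite eT inE.
have eI i : i \in e by rewrite eT inE.
have ie i : (index i e < n)%N by rewrite -[X in (_ < X)%N]se index_mem.
have fi : injective (fun i => Ordinal (ie i)).
  by move=> i j [] e1; rewrite -(nth_index i (eI i)) e1 nth_index.
exists (perm fi) => A B AM cB /existsP[i /and3P[iB iA /forallP ij]].
apply: (h A) => //; first by rewrite inE subsetT cB eqxx.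
apply/existsP; exists i; rewrite iB iA; apply/forallP => j.
by have := ij j; rewrite !permE.
Qed.

End MonomialSpaces.

Theorem theorem4p13 (K : fieldType) (n d : nat) (M : {set {set 'I_n}}) :
  (forall A, A \in M -> #|A| = d) ->
  Gotzmann K n d (monvs K n M) ->
  Gotzmann_dual K n d M ->
  is_lex_segment n d M.
Proof.
move=> Md hG hD; case: (leqP d n) => dn; last first.
  (* For [d > n] the family [M] is empty, so any order works. *)
  exists 1%g => A B /Md cA _; have := max_card (mem A).
  by rewrite card_ord cA leqNgt dn.
have MS : M \subset ksets [set: 'I_n] d.
  by apply/subsetP => A /Md cA; rewrite inE subsetT cA eqxx.
have cT : #|[set: 'I_n]| = n by rewrite cardsT card_ord.
apply: lexseg_is_lex_segment; apply: both_opt_lexseg; rewrite ?cT //; last first.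
  exact: Gotzmann_opt_shadow hG.
have GS := subsetDl (ksets [set: 'I_n] d) M.
have eD : alexdual n d M = cmpl [set: 'I_n] (ksets [set: 'I_n] d :\: M).
  rewrite /alexdual /cmpl; apply/setP => B.
  by apply/imsetP/imsetP => -[A]; rewrite !inE ?subsetT => h ->;
    exists A; rewrite ?setTD ?inE ?subsetT //= andbC.
(* Complementing the supports of the dual returns the nonmembers of [M], in degree
   [n - (n - d) = d]. *)
have := @Gotzmann_opt_shadow K n (n - d) (alexdual n d M) (leq_subr _ _).
rewrite eD (cmplK GS) subKn //; apply; last by rewrite -eD.
by have := cmpl_ksets GS; rewrite cT.
Qed.
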